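(* For each $n\ge1$ let $X_{n1},\dots,X_{nn}$ be i.i.d. random vectors in $\mathbb R^{p_n}$ with mean vector $\mu_n$ and covariance matrix $\Sigma_n$ (where $p_n\to\infty$ is allowed), and let $w_n\in\mathbb R^{p_n}$ be weighting vectors. Suppose that $$\lim_{n\to\infty}w_n'\Sigma_nw_n=\sigma_w^2>0$$ and that, for $r\in\{1,2\}$ and $k=1,\dots,r$, $$\sup_{n\ge1}E\big(|w_n'X_{n1}|^r\,\mathbf 1(|w_n'X_{n1}|^k>c)\big)\to0,\qquad c\to\infty.$$ Let $$\widehat\sigma_n^2=\frac1n\sum_{i=1}^n\big[w_n'X_{ni}-w_n'\overline X_n\big]^2,\qquad \overline X_n=\frac1n\sum_{i=1}^nX_{ni}.$$ Then, as $n\to\infty$: (i) $\widehat\sigma_n^2-w_n'\Sigma_nw_n\to0$ in probability and $\widehat\sigma_n^2\to\sigma_w^2$ in probability. (ii) $E(\widehat\sigma_n^2)-w_n'\Sigma_nw_n\to0$ and $E(\widehat\sigma_n^2)\to\sigma_w^2$.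
   Context: The prime denotes transposition and $\mathbf 1(\cdot)$ the indicator function. *)

(* Defs.v *)
From HB Require Import structures.
From mathcomp Require Import all_boot all_order all_algebra.
From mathcomp Require Import finmap.
From mathcomp Require Import all_classical all_reals all_analysis.

Set Implicit Arguments.
Unset Strict Implicit.
Unset Printing Implicit Defensive.

Import Order.TTheory GRing.Theory Num.Theory.
Import numFieldNormedType.Exports.

Local Open Scope classical_set_scope.
Local Open Scope ring_scope.

(* Column vectors of length p with their Borel sigma-algebra; convertible to
   'cV[R]_p, which itself carries no measurable structure in the library. *)
Notation borel_cV R p := (g_sigma_algebraType (@open 'cV[R]_p)).

Section random_vectors.
Context d (T : measurableType d) (R : realType) (P : probability T R).

Definition independent_RVs d' (T' : measurableType d') (I : set nat)
    (X : nat -> {RV P >-> T'}) : Prop :=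
  forall (J : {fset nat}) (B : nat -> set T'),
    [set` J] `<=` I ->
    (forall i, i \in J -> measurable (B i)) ->
    (P (\bigcap_(i in [set` J]) (X i @^-1` B i)) =
     \prod_(i <- J) P (X i @^-1` B i))%E.

(* Equality of laws is only required on measurable sets: `distribution` is a
   function on all sets. *)
Definition identically_distributed d' (T' : measurableType d') (I : set nat)
    (X : nat -> {RV P >-> T'}) : Prop :=
  forall i j, I i -> I j ->
    forall B : set T', measurable B ->
      distribution P (X i) B = distribution P (X j) B.

Definition iid d' (T' : measurableType d') (I : set nat)
    (X : nat -> {RV P >-> T'}) : Prop :=
  independent_RVs I X /\ identically_distributed I X.

Definition coordinate p (X : T -> 'cV[R]_p) (j : 'I_p) : T -> R :=
  fun t => X t j 0.

(* Integrability is required separately because the library's expectation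
   and covariance are total functions. *)
Definition has_mean_vector p (X : T -> 'cV[R]_p) (mu : 'cV[R]_p) : Prop :=
  forall j : 'I_p, coordinate X j \in Lfun P 1 /\
    'E_P[coordinate X j]%E = (mu j 0)%:E.

Definition has_covariance_matrix p (X : T -> 'cV[R]_p) (Sigma : 'M[R]_p)
    : Prop :=
  (forall j : 'I_p, coordinate X j \in Lfun P 2%:E) /\
  (forall j k : 'I_p,
    covariance P (coordinate X j) (coordinate X k) = (Sigma j k)%:E).

Definition cvg_in_probability (Y : nat -> T -> R) (Z : T -> R) : Prop :=
  forall e : R, 0 < e -> P [set t | e < `|Y n t - Z t|] @[n --> \oo] --> 0%E.

End random_vectors.

Section estimator.
Context (R : realType) (p : nat).

Definition dot (w x : 'cV[R]_p) : R := (w^T *m x) 0 0.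

Definition quadratic_form (w : 'cV[R]_p) (S : 'M[R]_p) : R :=
  (w^T *m S *m w) 0 0.

(* The sample is x 1, ..., x n; other values of x are ignored. *)
Definition sample_mean (n : nat) (x : nat -> 'cV[R]_p) : 'cV[R]_p :=
  n%:R^-1 *: \sum_(1 <= i < n.+1) x i.

Definition weighted_sample_variance (n : nat) (w : 'cV[R]_p)
    (x : nat -> 'cV[R]_p) : R :=
  n%:R^-1 * \sum_(1 <= i < n.+1) (dot w (x i) - dot w (sample_mean n x)) ^+ 2.

End estimator.

(* Main.v *)
(* Write Y_i = w_n'X_ni, with mean m and variance v = w_n' Sigma_n w_n, and split
   Y_i^2 = V_i + W_i with W_i = Y_i^2 1(Y_i^2 > c). The estimator S satisfies
     S - v = (mean V - E V) + (mean W - E W) - (Ybar - m)^2 - 2 m (Ybar - m).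
   The V_i are bounded by c and uncorrelated, so E (mean V - E V)^2 <= c^2 / n;
   E W is small by uniform integrability; E (Ybar - m)^2 <= v / n. Hence
   S - v -> 0 in L^1, which gives both the convergence in probability (Markov)
   and the convergence of the expectations. *)

Require Import Defs.
From HB Require Import structures.
From mathcomp Require Import all_boot all_order all_algebra.
From mathcomp Require Import finmap.
From mathcomp Require Import all_classical all_reals all_analysis.
From mathcomp Require Import measurable_realfun.
From mathcomp Require Import ring lra.

Set Implicit Arguments.
Unset Strict Implicit.
Unset Printing Implicit Defensive.

Import Order.TTheory GRing.Theory Num.Theory.
Import numFieldNormedType.Exports.

Local Open Scope classical_set_scope.
Local Open Scope ring_scope.

(** * Measurability of linear functionals on column vectors *)

(** Open intervals generate the Borel sets of [R], and their preimages under [f] are open, hence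
    generators of the sigma-algebra of [borel_cV R p]. *)
Lemma continuous_measurable_borel_cV (R : realType) (p : nat)
    (f : 'cV[R]_p -> R) :
  continuous f -> measurable_fun [set: borel_cV R p] (f : borel_cV R p -> R).
Proof.
move=> cf; apply: (measurability _ (RGenOpens.measurableE R)).
move=> _ [_ [x [y ->] <-]]; rewrite setTI.
apply: sub_sigma_algebra.
by apply: open_comp => //; exact: interval_open.
Qed.

Lemma dotE (R : realType) (p : nat) (w x : 'cV[R]_p) :
  dot w x = \sum_j w j 0 * x j 0.
Proof. by rewrite /dot mxE; apply: eq_bigr => j _; rewrite mxE. Qed.

Lemma measurable_dot (R : realType) (p : nat) (w : 'cV[R]_p) :
  measurable_fun [set: borel_cV R p] (dot w : borel_cV R p -> R).
Proof.
apply: continuous_measurable_borel_cV.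
rewrite (_ : dot w = fun x => \sum_j w j 0 * x j 0); last first.
  by apply/funext => x; rewrite dotE.
apply: continuous_big => [|j _ x]; first exact: add_continuous.
apply: (@cvgMr _ _ (nbhs x)); exact: (@coord_continuous R p 1 j 0 x).
Qed.

(** * Consequences of independence and of equality in law *)

Section independence.
Context d (T : measurableType d) (R : realType) (P : probability T R).

(** The product rule on rectangles determines the joint law of [(U, V)]: it is the product of the
    marginal laws. Fubini for the function z.1 * z.2 then separates the two integrals. *)
Lemma independent_expectationM (U V : {RV P >-> R}) :
    (forall A B : set R, measurable A -> measurable B ->
      P (U @^-1` A `&` V @^-1` B) = (P (U @^-1` A) * P (V @^-1` B))%E) ->
    (U : T -> R) \in Lfun P 1 -> (V : T -> R) \in Lfun P 1 ->
    (U \* V)%R \in Lfun P 1 ->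
  ('E_P[U \* V] = 'E_P[U] * 'E_P[V])%E.
Proof.
move=> UV U1 V1 UV1.
have mUV : measurable_fun [set: T] (fun t => (U t, V t)).
  exact: measurable_fun_pair.
pose UVmix := isMeasurableFun.Build _ _ _ _ _ mUV.
pose UVp : {mfun T >-> (R * R)%type} := HB.pack (fun t => (U t, V t)) UVmix.
pose mU : probability R R := distribution P U.
pose mV : probability R R := distribution P V.
pose f := fun z : R * R => (z.1 * z.2)%:E.
have mf : measurable_fun [set: R * R] f.
  by apply/measurable_EFinP; apply: measurable_funM;
    [exact: measurable_fst|exact: measurable_snd].
have joint A : measurable A -> (mU \x mV)%E A = distribution P UVp A.
  by apply: product_measure_unique => B C mB mC; rewrite -UV.
have fi : P.-integrable [set: T] (f \o UVp) by exact/Lfun1_integrable.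
(* Fubini needs integrability under the product measure; it is transported from [P] through the
   joint law. *)
have fi2 : (mU \x mV)%E.-integrable [set: R * R] f.
  apply/integrableP; split=> //.
  rewrite (eq_measure_integral (distribution P UVp)); last first.
    by move=> A mA _; exact: joint.
  have /integrableP[_] := integrable_pushforward (measurable_funP UVp)
    mf fi measurableT.
  by [].
transitivity (\int[mU \x mV]_z f z)%E.
  rewrite unlock (eq_measure_integral (distribution P UVp)); last first.
    by move=> A mA _; exact: joint.
  by rewrite integral_distribution.
rewrite -integral12_prod_meas1//= /fubini_F/= /f/=.
have mid : measurable_fun [set: R] (EFin : R -> \bar R) by exact/measurable_EFinP.
have Ui : P.-integrable [set: T] (EFin \o U) by exact/Lfun1_integrable.
have Vi : P.-integrable [set: T] (EFin \o V) by exact/Lfun1_integrable.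
have mVi : mV.-integrable [set: R] EFin.
  exact: (@integrable_pushforward _ _ _ _ _ _ (measurable_funPT V) P setT _ mid Vi).
have mUi : mU.-integrable [set: R] EFin.
  exact: (@integrable_pushforward _ _ _ _ _ _ (measurable_funPT U) P setT _ mid Ui).
have EU : (\int[mU]_x x%:E = 'E_P[U])%E.
  by rewrite unlock integral_distribution.
have EV : (\int[mV]_x x%:E = 'E_P[V])%E.
  by rewrite unlock integral_distribution.
under eq_integral => x _.
  under eq_integral do rewrite EFinM.
  rewrite integralZl// EV.
  over.
by rewrite -(fineK (expectation_fin_num V1)) integralZr// EU.
Qed.


Lemma Lfun_measurable (r : \bar R) (f : T -> R) :
  f \in Lfun P r -> measurable_fun [set: T] f.
Proof. by move=> /sub_Lfun_mfun; rewrite inE. Qed.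

Lemma independent_covariance0 d' (T' : measurableType d') (I : set nat)
    (X : nat -> {RV P >-> T'}) (f : T' -> R) (i j : nat) :
    independent_RVs I X -> I i -> I j -> i != j ->
    measurable_fun [set: T'] f ->
    f \o X i \in Lfun P 2%:E -> f \o X j \in Lfun P 2%:E ->
  covariance P (f \o X i) (f \o X j) = 0%E.
Proof.
move=> indX Ii Ij ij mf Xi2 Xj2.
have Pfin : P setT \is a fin_num := fin_num_measure P _ measurableT.
have Xi1 := Lfun_subset12 Pfin Xi2.
have Xj1 := Lfun_subset12 Pfin Xj2.
have XX1 := Lfun2_mul_Lfun1 Xi2 Xj2.
have [Umix Vmix] := (isMeasurableFun.Build _ _ _ _ _ (Lfun_measurable Xi1),
  isMeasurableFun.Build _ _ _ _ _ (Lfun_measurable Xj1)).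
pose U : {mfun T >-> R} := HB.pack (f \o X i) Umix.
pose V : {mfun T >-> R} := HB.pack (f \o X j) Vmix.
rewrite covarianceE// -[(_ * _)%R]/(U \* V)%R.
rewrite independent_expectationM// ?subee//.
  by rewrite fin_numM// expectation_fin_num.
move=> A B mA mB.
have mfpre C : measurable C -> measurable (f @^-1` C).
  by move=> mC; rewrite -[_ @^-1` _]setTI; exact: mf.
(* Independence is applied to the two-element family {i, j}; since i != j, this choice gives the
   preimage of [A] at [i] and that of [B] at [j]. *)
pose C k := if k == i then f @^-1` A else f @^-1` B.
have := indX [fset i; j]%fset C.
rewrite big_fsetU1/= ?inE// big_seq_fset1 /C eqxx eq_sym (negbTE ij).
move=> <-.
- congr (P _); apply/seteqP; split => t /=.
    move=> [At Bt] k /=; rewrite !inE => /orP[]/eqP ->; first by rewrite eqxx.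
    by rewrite eq_sym (negbTE ij).
  move=> h; split.
    by have := h i; rewrite /= !inE eqxx; exact.
  by have := h j; rewrite /= !inE eqxx orbT eq_sym (negbTE ij); exact.
- by move=> k /=; rewrite !inE => /orP[]/eqP ->.
- by move=> k _; case: ifPn => _; exact: mfpre.
Qed.

(** Both expectations are integrals of [f] against the same law. Nonnegativity of [f] permits the
    change of variables before integrability is known, as is the case for the truncated squares. *)
Lemma identically_distributed_expectation d' (T' : measurableType d')
    (I : set nat) (X : nat -> {RV P >-> T'}) (f : T' -> R) (i j : nat) :
    identically_distributed I X -> I i -> I j ->
    measurable_fun [set: T'] f -> (forall x, 0 <= f x) ->
  ('E_P[f \o X i] = 'E_P[f \o X j])%E.
Proof.
move=> idX Ii Ij mf f0; rewrite unlock.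
have mEf : measurable_fun [set: T'] (EFin \o f) by exact/measurable_EFinP.
transitivity (\int[distribution P (X i)]_y (f y)%:E)%E.
  by rewrite ge0_integral_distribution// => y; rewrite lee_fin.
rewrite (eq_measure_integral (distribution P (X j))).
  by rewrite ge0_integral_distribution// => y; rewrite lee_fin.
by move=> A mA _; exact: idX.
Qed.

(** * Sums and means of uncorrelated variables *)

Lemma Lfun_sum (q : R) (I : Type) (r : seq I) (Q : pred I) (F : I -> T -> R) :
    1 <= q -> (forall i, Q i -> F i \in Lfun P q%:E) ->
  \sum_(i <- r | Q i) F i \in Lfun P q%:E.
Proof.
move=> q1 Fq; apply: (big_ind (fun f => f \in Lfun P q%:E)) => //.
  exact: Lfun_cst.
by move=> f g fq gq; rewrite rpredD ?lee_fin.
Qed.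

(** Induction on the number of terms: each partial sum is uncorrelated with every later term
    ([covS]), so the cross term in the variance vanishes. *)
Lemma uncorrelated_variance_sum (U : nat -> T -> R) (n : nat) (v : R) :
    (forall i, (1 <= i <= n)%N -> U i \in Lfun P 2%:E) ->
    (forall i, (1 <= i <= n)%N -> ('V_P[U i] <= v%:E)%E) ->
    (forall i j, (1 <= i <= n)%N -> (1 <= j <= n)%N -> i != j ->
      covariance P (U i) (U j) = 0%E) ->
  ('V_P[(\sum_(1 <= i < n.+1) U i)%R] <= (n%:R * v)%:E)%E.
Proof.
move=> U2 Uv Ucov.
have S2 m : (m <= n)%N -> \sum_(1 <= i < m.+1) U i \in Lfun P 2%:E.
  move=> mn; rewrite big_nat_cond; apply: Lfun_sum => [|i]; first exact: ler1n.
  by rewrite andbT ltnS => /andP[i1 im]; apply: U2; rewrite i1 (leq_trans im).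
have covS m j : (m < j <= n)%N ->
    covariance P (\sum_(1 <= i < m.+1) U i) (U j) = 0%E.
  move=> /andP[+ jn].
  elim: m => [|m ih] mj; first by rewrite big_geq// covariance_cst_l.
  have mn : (m.+1 <= n)%N by rewrite (leq_trans _ jn)// ltnW.
  have j1 : (1 <= j <= n)%N by rewrite jn andbT (leq_trans _ mj).
  rewrite big_nat_recr//= covarianceDl//; [|exact/S2/ltnW|exact: U2|exact: U2].
  rewrite ih ?(ltnW mj)// add0e Ucov//.
  by rewrite neq_ltn mj.
suff : forall m, (m <= n)%N ->
    ('V_P[(\sum_(1 <= i < m.+1) U i)%R] <= (m%:R * v)%:E)%E by exact.
elim=> [_|m ih mn]; first by rewrite big_geq// variance_cst mul0r.
rewrite big_nat_recr//= varianceD ?U2 ?S2 ?(ltnW mn)//.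
rewrite covS ?ltnSn// mule0 adde0 -natr1 mulrDl mul1r EFinD.
by rewrite leeD ?Uv// ih// ltnW.
Qed.

(** The mean has expectation [a], so its mean squared deviation is its variance, that is, n^-2 times
    a variance of at most n * v. *)
Lemma uncorrelated_mean_sqr_dev (U : nat -> T -> R) (n : nat) (a v : R) :
    (0 < n)%N ->
    (forall i, (1 <= i <= n)%N -> U i \in Lfun P 2%:E) ->
    (forall i, (1 <= i <= n)%N -> ('E_P[U i] = a%:E)%E) ->
    (forall i, (1 <= i <= n)%N -> ('V_P[U i] <= v%:E)%E) ->
    (forall i j, (1 <= i <= n)%N -> (1 <= j <= n)%N -> i != j ->
      covariance P (U i) (U j) = 0%E) ->
  ('E_P[(fun t => ((n%:R^-1 * \sum_(1 <= i < n.+1) U i t) - a) ^+ 2)%R]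
    <= (v / n%:R)%:E)%E.
Proof.
move=> n0 U2 Ua Uv Ucov.
have Pfin : P setT \is a fin_num := fin_num_measure P _ measurableT.
have S2 : \sum_(1 <= i < n.+1) U i \in Lfun P 2%:E.
  by rewrite big_nat; apply: Lfun_sum => [|i]; [exact: ler1n|exact: U2].
have nn0 : n%:R != 0 :> R by rewrite pnatr_eq0 -lt0n.
have ES : ('E_P[\sum_(1 <= i < n.+1) U i] = (n%:R * a)%:E)%E.
  rewrite -(big_map U xpredT id) expectation_sum.
    rewrite big_map big_nat (eq_bigr (fun=> a%:E)); last by move=> i; exact: Ua.
    by rewrite -big_nat sumEFin sumr_const_nat subn1 mulr_natl.
  move=> f /mapP[i]; rewrite mem_index_iota => iin ->.
  exact: Lfun_subset12 (U2 i iin).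
pose Z : T -> R := n%:R^-1 \o* \sum_(1 <= i < n.+1) U i.
have EZ : ('E_P[Z] = a%:E)%E.
  by rewrite expectationZl ?Lfun_subset12// ES -EFinM mulKf.
rewrite [leLHS](_ : _ = 'V_P[Z]); last first.
  rewrite /variance [in RHS]unlock EZ; congr expectation; apply/funext => t.
  by rewrite mulrfctE /Z /= fct_sumE expr2 [_^-1 * _]mulrC.
rewrite varianceZ//.
have := uncorrelated_variance_sum U2 Uv Ucov.
rewrite -(fineK (variance_fin_num S2)) lee_fin -EFinM => le_v.
rewrite lee_fin expr2 -mulrA mulrC ler_pM2r ?invr_gt0 ?ltr0n//.
by rewrite mulrC ler_pdivrMr ?ltr0n// mulrC.
Qed.

(** * The L^1 bound for the sample variance of uncorrelated variables *)

(** [V] is the part of Y^2 with controlled variance and [W] the remainder with small expectation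
    [omega]. The free parameter [delta] trades the constant term against the terms that decay like
    1/n. *)
Lemma variance_L1_bound (n : nat) (Y V W : nat -> T -> R)
    (m v u omega delta : R) :
    (0 < n)%N -> 0 < delta ->
    (forall i, (1 <= i <= n)%N -> Y i \in Lfun P 2%:E) ->
    (forall i, (1 <= i <= n)%N -> ('E_P[Y i] = m%:E)%E) ->
    (forall i, (1 <= i <= n)%N -> ('V_P[Y i] = v%:E)%E) ->
    (forall i j, (1 <= i <= n)%N -> (1 <= j <= n)%N -> i != j ->
      covariance P (Y i) (Y j) = 0%E) ->
    (forall i, (1 <= i <= n)%N -> V i \in Lfun P 2%:E) ->
    (forall i, (1 <= i <= n)%N -> ('V_P[V i] <= u%:E)%E) ->
    (forall i j, (1 <= i <= n)%N -> (1 <= j <= n)%N -> i != j ->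
      covariance P (V i) (V j) = 0%E) ->
    (forall i t, 0 <= W i t) ->
    (forall i t, Y i t ^+ 2 = V i t + W i t) ->
    (forall i, (1 <= i <= n)%N -> ('E_P[W i] = omega%:E)%E) ->
  let Ybar t := n%:R^-1 * \sum_(1 <= i < n.+1) Y i t in
  let S t := n%:R^-1 * \sum_(1 <= i < n.+1) (Y i t - Ybar t) ^+ 2 in
  S \in Lfun P 1 /\
  ('E_P[(fun t => `|S t - v|)%R] <=
    (2 * omega + delta * (1 + m ^+ 2)
      + (u / delta + v + v / delta) / n%:R)%:E)%E.
Proof.
move=> n0 d0 Y2 Ym Yv Ycov V2 Vu Vcov W0 YVW Wo Ybar S.
have Pfin : P setT \is a fin_num := fin_num_measure P _ measurableT.
have nn0 : n%:R != 0 :> R by rewrite pnatr_eq0 -lt0n.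
have L1 (F : nat -> T -> R) :
    (forall i, (1 <= i <= n)%N -> F i \in Lfun P 1) ->
    (fun t => n%:R^-1 * \sum_(1 <= i < n.+1) F i t) \in Lfun P 1.
  move=> F1; rewrite (_ : (fun _ => _) =
      n%:R^-1 \o* \sum_(1 <= i < n.+1) F i); last first.
    by apply/funext => t /=; rewrite fct_sumE mulrC.
  by apply: Lfun_scale => //; rewrite big_nat; apply: Lfun_sum.
have L2 (F : nat -> T -> R) :
    (forall i, (1 <= i <= n)%N -> F i \in Lfun P 2%:E) ->
    (fun t => n%:R^-1 * \sum_(1 <= i < n.+1) F i t) \in Lfun P 2%:E.
  move=> F1; rewrite (_ : (fun _ => _) =
      n%:R^-1 \o* \sum_(1 <= i < n.+1) F i); last first.
    by apply/funext => t /=; rewrite fct_sumE mulrC.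
  apply: Lfun_scale; rewrite ?ler1n// big_nat.
  by apply: Lfun_sum; rewrite ?ler1n.
have sqr1 (f : T -> R) : f \in Lfun P 2%:E -> (fun t => f t ^+ 2) \in Lfun P 1.
  by move=> f2; have := Lfun2_mul_Lfun1 f2 f2.
have subL2 (f g : T -> R) : f \in Lfun P 2%:E -> g \in Lfun P 2%:E ->
    (fun t => f t - g t) \in Lfun P 2%:E.
  by move=> f2 g2; rewrite -[X in X \in _]/(f \- g) rpredB ?lee1n.
have S1 : S \in Lfun P 1.
  by apply: L1 => i hi; apply/sqr1/subL2; [exact: Y2|exact: L2].
split=> //.
have W1 i : (1 <= i <= n)%N -> W i \in Lfun P 1.
  move=> hi; rewrite (_ : W i = (fun t => Y i t ^+ 2) \- V i).
    by rewrite rpredB//; [exact/sqr1/Y2|exact: Lfun_subset12 (V2 i hi)].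
  by apply/funext => t /=; rewrite YVW addrAC subrr add0r.
(* E V_i = E Y_i^2 - E W_i, where E Y_i^2 = v + m^2. *)
have Vm i : (1 <= i <= n)%N -> ('E_P[V i] = (v + m ^+ 2 - omega)%:E)%E.
  move=> hi; have Y21 := sqr1 _ (Y2 i hi).
  rewrite (_ : V i = (fun t => Y i t ^+ 2) \- W i); last first.
    by apply/funext => t /=; rewrite YVW addrK.
  rewrite expectationB ?W1// Wo// -(fineK (expectation_fin_num Y21)).
  have := varianceE (Y2 i hi); rewrite Yv// Ym//.
  rewrite (_ : (Y i ^+ 2)%R = (fun t => Y i t ^+ 2)); last by [].
  rewrite -(fineK (expectation_fin_num Y21)) -EFin_expe -!EFinB => -[->].
  by rewrite subrK.
pose a := v + m ^+ 2 - omega.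
pose A t := n%:R^-1 * \sum_(1 <= i < n.+1) V i t.
pose B t := n%:R^-1 * \sum_(1 <= i < n.+1) W i t.
have A2 : A \in Lfun P 2%:E by exact: L2.
have B1 : B \in Lfun P 1 by exact: L1.
have Ybar2 : Ybar \in Lfun P 2%:E by exact: L2.
have B0 t : 0 <= B t by rewrite mulr_ge0// sumr_ge0.
pose G t := (A t - a) ^+ 2.
pose H t := (Ybar t - m) ^+ 2.
have G1 : G \in Lfun P 1 by apply/sqr1/subL2 => //; exact: Lfun_cst.
have H1 : H \in Lfun P 1 by apply/sqr1/subL2 => //; exact: Lfun_cst.
have EG : ('E_P[G] <= (u / n%:R)%:E)%E by exact: uncorrelated_mean_sqr_dev.
have EH : ('E_P[H] <= (v / n%:R)%:E)%E.
  by apply: uncorrelated_mean_sqr_dev => // i hi; rewrite Yv.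
have EB : ('E_P[B] = omega%:E)%E.
  rewrite (_ : B = n%:R^-1 \o* \sum_(1 <= i < n.+1) W i); last first.
    by apply/funext => t /=; rewrite fct_sumE mulrC.
  rewrite expectationZl; last by rewrite big_nat; exact: Lfun_sum.
  rewrite -(big_map W xpredT id) expectation_sum.
    rewrite big_map big_nat (eq_bigr (fun=> omega%:E)); last by move=> i; exact: Wo.
    by rewrite -big_nat sumEFin sumr_const_nat subn1 -EFinM -[omega *+ _]mulr_natl mulKf.
  by move=> f /mapP[i]; rewrite mem_index_iota => iin ->; exact: W1.
(* The mean of (Y_i - Ybar)^2 is the mean of Y_i^2 minus Ybar^2, and Y_i^2 = V_i + W_i. *)
have SE t : S t = A t + B t - Ybar t ^+ 2.
  rewrite /S /A /B -mulrDr -big_split/=.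
  rewrite (eq_bigr (fun i => Y i t ^+ 2 - 2 * Ybar t * Y i t + Ybar t ^+ 2)); last first.
    by move=> i _; ring.
  rewrite big_split sumrB /= -mulr_sumr sumr_const_nat subn1 /=.
  rewrite (eq_bigr (fun i => V i t + W i t)); last by move=> i _; exact: YVW.
  rewrite /Ybar -[_ *+ _]mulr_natl; field.
  by rewrite nn0.
(* [K k0] is an integrable majorant of |S - v|. In [k0], [omega] pays for centring [B], and
   [delta * (1 + m ^+ 2)] pays for the terms linear in A - a and in m * (Ybar - m). *)
pose K k : T -> R := cst k \+ B \+ delta^-1 \o* G \+ (1 + delta^-1) \o* H.
pose k0 := omega + delta * (1 + m ^+ 2).
have omega0 : 0 <= omega.
  by rewrite -lee_fin -EB; exact: expectation_ge0.
(* AM-GM turns the terms linear in A - a and Ybar - m into the squares whose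
   expectations are controlled, at the price of a multiple of delta. *)
have amgm (x y : R) : 2 * (x * y) <= delta * x ^+ 2 + y ^+ 2 / delta.
  rewrite -subr_ge0 (_ : _ - _ = (delta * x - y) ^+ 2 / delta).
    by rewrite divr_ge0 ?sqr_ge0// ltW.
  by field; rewrite gt_eqF.
have le_K t : `|S t - v| <= K k0 t.
  rewrite SE /K /k0 /= /G /H.
  (* Each instance is taken with both signs, to bound S - v from above and from below. *)
  have := (amgm 1 (A t - a), amgm 1 (- (A t - a)),
    amgm m (Ybar t - m), amgm m (- (Ybar t - m))).
  rewrite !sqrrN expr1n !mulr1 !mul1r => -[[[h1 h2] h3] h4].
  have := (B0 t, sqr_ge0 (Ybar t - m), sqr_ge0 m).
  have -> : A t + B t - Ybar t ^+ 2 - v =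
      (A t - a) + B t - omega - (Ybar t - m) ^+ 2 - 2 * (m * (Ybar t - m)).
    by rewrite /a; ring.
  move: h1 h2 h3 h4; rewrite [m * - _]mulrN.
  set x := A t - a; set z := (Ybar t - m) ^+ 2; set y := m * (Ybar t - m).
  set x2 := x ^+ 2 / delta; set z2 := z / delta.
  move=> h1 h2 h3 h4 [[h5 h6] h7].
  rewrite !mulrDr !mulr1 -/z2.
  by rewrite ler_norml; apply/andP; split; lra.
have S0 : measurable_fun [set: T] S := Lfun_measurable S1.
have KL k : K k \in Lfun P 1.
  by rewrite /K !rpredD ?Lfun_scale ?Lfun_cst.
have K0 t : 0 <= K k0 t by exact: le_trans (le_K t).
apply: (@le_trans _ _ ('E_P[K k0])%E).
  apply: expectation_le => //.
  - by apply: measurableT_comp => //; exact: measurable_funB.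
  - exact: (Lfun_measurable (KL k0)).
  - exact: aeW.
have EK k : ('E_P[K k] <= k%:E + omega%:E +
    delta^-1%:E * (u / n%:R)%:E + (1 + delta^-1)%:E * (v / n%:R)%:E)%E.
  have di0 : 0 <= delta^-1 by rewrite invr_ge0 ltW.
  rewrite /K !expectationD ?rpredD ?Lfun_scale ?Lfun_cst//.
  rewrite expectation_cst EB !expectationZl//.
  apply: leeD; [apply: leeD => //|];
    by apply: lee_wpmul2l => //; rewrite lee_fin ?addr_ge0.
apply: (le_trans (EK k0)).
rewrite -!EFinM -!EFinD lee_fin le_eqVlt; apply/orP; left; apply/eqP.
by rewrite /k0; field; rewrite nn0 gt_eqF.
Qed.

(** * Bounded variables, and linearity of the covariance *)

Lemma Lfun2_bounded (f : T -> R) (c : R) :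
    measurable_fun [set: T] f -> (forall t, 0 <= f t <= c) ->
  f \in Lfun P 2%:E.
Proof.
move=> mf fc.
rewrite inE; apply/andP; split; rewrite inE//=.
rewrite /finite_norm unlock poweR_lty//=.
apply: (@le_lt_trans _ _ (\int[P]_x (cst (c `^ 2)%:E x))%E).
  apply: ge0_le_integral => //=.
  - apply/measurable_EFinP; apply: (@measurableT_comp _ _ _ _ _ _ (@powR R ^~ 2)) => //.
    exact: measurableT_comp.
  - move=> t _; have /andP[f0 f_c] := fc t.
    rewrite lee_fin ger0_norm// ge0_ler_powR// nnegrE.
    exact: le_trans f_c.
rewrite (@integral_cst _ _ _ P _ measurableT) lte_mul_pinfty ?lee_fin ?powR_ge0//.
by rewrite ltey_eq fin_num_measure.
Qed.

(** The variance is at most the second moment, and f^2 <= c^2 pointwise. *)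
Lemma variance_bounded (f : T -> R) (c : R) :
    measurable_fun [set: T] f -> (forall t, 0 <= f t <= c) ->
  ('V_P[f] <= (c ^+ 2)%:E)%E.
Proof.
move=> mf fc; rewrite (varianceE (Lfun2_bounded mf fc)).
have Pfin : P setT \is a fin_num := fin_num_measure P _ measurableT.
have f1 : f \in Lfun P 1 := Lfun_subset12 Pfin (Lfun2_bounded mf fc).
apply: (@le_trans _ _ 'E_P[(f ^+ 2)%R]%E).
  rewrite -(fineK (expectation_fin_num f1)) -EFin_expe leeBlDr// leeDl//.
  by rewrite lee_fin sqr_ge0.
rewrite -(expectation_cst P); apply: expectation_le => //.
- exact: (measurable_funX 2 mf).
- by move=> t; exact: sqr_ge0.
- by move=> t; exact: sqr_ge0.
- apply: aeW => t; have /andP[f0 f_c] := fc t.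
  suff : f t ^+ 2 <= c ^+ 2 by [].
  by rewrite lerXn2r// nnegrE (le_trans f0).
Qed.

Lemma covariance_suml (I : Type) (r : seq I) (a : I -> R) (f : I -> T -> R)
    (g : T -> R) :
    (forall i, f i \in Lfun P 2%:E) -> g \in Lfun P 2%:E ->
  covariance P (\sum_(i <- r) a i \o* f i) g =
  (\sum_(i <- r) (a i)%:E * covariance P (f i) g)%E.
Proof.
move=> f2 g2.
have Pfin : P setT \is a fin_num := fin_num_measure P _ measurableT.
elim: r => [|i r ih]; first by rewrite !big_nil covariance_cst_l.
rewrite !big_cons covarianceDl ?Lfun_scale ?ler1n//.
  have [fi1 g1] := (Lfun_subset12 Pfin (f2 i), Lfun_subset12 Pfin g2).
  rewrite covarianceZl//; last exact: (Lfun2_mul_Lfun1 (f2 i) g2).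
  by congr (_ + _)%E; exact: ih.
by apply: Lfun_sum => [|j _]; rewrite ?ler1n// Lfun_scale ?ler1n.
Qed.

(** * First and second moments of w'X *)

Section weighted_vector.
Variables (p : nat) (X : T -> 'cV[R]_p).
Variables (mu w : 'cV[R]_p) (Sigma : 'M[R]_p).
Hypothesis X_mean : has_mean_vector P X mu.
Hypothesis X_cov : has_covariance_matrix P X Sigma.

Let dot_sum : dot w \o X = \sum_j w j 0 \o* coordinate X j.
Proof.
apply/funext => t; rewrite /= dotE fct_sumE; apply: eq_bigr => j _.
by rewrite /= mulrC.
Qed.

Lemma Lfun2_dot : dot w \o X \in Lfun P 2%:E.
Proof.
have [X2 _] := X_cov.
by rewrite dot_sum; apply: Lfun_sum => [|j _]; rewrite ?ler1n// Lfun_scale ?ler1n.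
Qed.

Lemma expectation_dot : ('E_P[dot w \o X] = (dot w mu)%:E)%E.
Proof.
rewrite dot_sum -(big_map (fun j => w j 0 \o* coordinate X j) xpredT id).
rewrite expectation_sum => [|f /mapP[j _ ->]]; last first.
  by have [X1 _] := X_mean j; rewrite Lfun_scale.
rewrite big_map dotE -sumEFin; apply: eq_bigr => j _.
by have [X1 Xj] := X_mean j; rewrite expectationZl// Xj.
Qed.

Lemma variance_dot : 'V_P[dot w \o X] = (quadratic_form w Sigma)%:E.
Proof.
have [X2 Xjk] := X_cov.
have D2 := Lfun2_dot.
rewrite /variance {1}dot_sum covariance_suml//.
under eq_bigr => j _.
  (* Symmetry of the covariance lets linearity in the first argument expand the second one too; the
     resulting index order Sigma_kj is that of (w' Sigma) w. *)
  rewrite covarianceC dot_sum covariance_suml//.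
  under eq_bigr => k _ do rewrite Xjk -EFinM.
  rewrite sumEFin -EFinM.
  over.
rewrite sumEFin /quadratic_form mxE; congr EFin; apply: eq_bigr => j _.
by rewrite mxE mulrC; congr (_ * _); apply: eq_bigr => k _; rewrite mxE.
Qed.
End weighted_vector.
End independence.

(** * Truncation of squares *)

(* Syntactically the integrand of the truncation hypothesis for r = k = 2. *)
Definition sqr_tail (R : realType) (c y : R) : R :=
  `|y| ^+ 2 * \1_[set z | c < `|z| ^+ 2] y.

Lemma sqr_tail_ge0 (R : realType) (c y : R) : 0 <= sqr_tail c y.
Proof. by rewrite /sqr_tail mulr_ge0// sqr_ge0. Qed.

(** The difference is y^2 where y^2 <= c and 0 elsewhere. This is the bounded part V_i of the
    splitting. *)
Lemma sqr_tail_compl (R : realType) (c y : R) :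
  0 <= c -> 0 <= y ^+ 2 - sqr_tail c y <= c.
Proof.
move=> c0; rewrite /sqr_tail real_normK ?num_real// indicE.
have [cy|] := boolP (c < `|y| ^+ 2).
  by rewrite mem_set// mulr1 subrr lexx.
rewrite -leNgt => yc; rewrite memNset/=; last by apply/negP; rewrite -leNgt.
by rewrite mulr0 subr0 sqr_ge0 -(real_normK (num_real y)).
Qed.

Lemma measurable_sqr_tail (R : realType) (c : R) :
  measurable_fun [set: R] (sqr_tail c).
Proof.
have msqr : measurable_fun [set: R] (fun z : R => `|z| ^+ 2).
  exact: measurable_funX.
apply: measurable_funM => //.
apply: measurable_indic.
rewrite (_ : [set _ | _] = (fun z : R => `|z| ^+ 2) @^-1` `]c, +oo[).
  by rewrite -[_ @^-1` _]setTI; exact: msqr.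
by apply/seteqP; split => z /=; rewrite in_itv/= andbT.
Qed.

(** * The L^1 bound for an i.i.d. sample of weighted vectors *)

Lemma dot_sample_mean (R : realType) (p n : nat) (w : 'cV[R]_p)
    (x : nat -> 'cV[R]_p) :
  dot w (sample_mean n x) = n%:R^-1 * \sum_(1 <= i < n.+1) dot w (x i).
Proof.
by rewrite /dot /sample_mean -scalemxAr mxE mulmx_sumr summxE.
Qed.

(** The bound involves only [c], [eps], [delta] and [n]: the mean and variance of w'X are absorbed
    through E (w'X)^2 <= c + eps. It is therefore uniform over the dimension, the weights and the
    law of the sample. *)
Lemma weighted_sample_variance_L1_bound d (T : measurableType d) (R : realType)
    (P : probability T R) (p n : nat) (X : nat -> {RV P >-> borel_cV R p})
    (mu w : 'cV[R]_p) (Sigma : 'M[R]_p) (c eps delta : R) :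
    (0 < n)%N -> 0 <= c -> 0 < delta ->
    iid [set i : nat | (1 <= i <= n)%N] X ->
    (forall i, (1 <= i <= n)%N -> has_mean_vector P (X i) mu) ->
    (forall i, (1 <= i <= n)%N -> has_covariance_matrix P (X i) Sigma) ->
    ('E_P[(sqr_tail c \o (dot w \o X 1%N))%R] <= eps%:E)%E ->
  let S t := weighted_sample_variance n w (fun i => X i t) in
  S \in Lfun P 1 /\
  ('E_P[(fun t => `|S t - quadratic_form w Sigma|)%R] <=
    (2 * eps + delta * (1 + (c + eps))
      + (c ^+ 2 / delta + (c + eps) + (c + eps) / delta) / n%:R)%:E)%E.
Proof.
move=> n0 c0 d0 [indX idX] Xmu XSigma tail_eps S.
have Pfin : P setT \is a fin_num := fin_num_measure P _ measurableT.
pose Y i : T -> R := dot w \o X i.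
pose W i : T -> R := sqr_tail c \o Y i.
pose V i : T -> R := fun t => Y i t ^+ 2 - W i t.
have mY i : measurable_fun [set: T] (Y i).
  exact: measurableT_comp (measurable_dot w) _.
have mW i : measurable_fun [set: T] (W i).
  exact: measurableT_comp (measurable_sqr_tail c) (mY i).
have mV i : measurable_fun [set: T] (V i).
  by apply: measurable_funB => //; exact: measurable_funX.
have Vc i t : 0 <= V i t <= c by exact: sqr_tail_compl.
have V2 i : V i \in Lfun P 2%:E := Lfun2_bounded P (mV i) (Vc i).
have Y2 i : (1 <= i <= n)%N -> Y i \in Lfun P 2%:E.
  by move=> hi; exact: Lfun2_dot (XSigma i hi).
have one : (1 <= 1 <= n)%N by rewrite n0.
(* Finiteness ensures that [fine] below returns the actual expectation and not its default value. *)
have Wfin : 'E_P[W 1%N]%E \is a fin_num.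
  rewrite ge0_fin_numE.
    exact: le_lt_trans tail_eps (ltry _).
  by apply: expectation_ge0 => t; exact: sqr_tail_ge0.
pose omega := fine 'E_P[W 1%N]%E.
have W1 : 'E_P[W 1%N]%E = omega%:E by rewrite fineK.
have omega_eps : omega <= eps by rewrite -lee_fin -W1.
have mtail : measurable_fun [set: borel_cV R p]
    (sqr_tail c \o dot w : borel_cV R p -> R).
  exact: measurableT_comp (measurable_sqr_tail c) (measurable_dot w).
have Womega i : (1 <= i <= n)%N -> 'E_P[W i]%E = omega%:E.
  move=> hi; rewrite -W1.
  exact: (identically_distributed_expectation idX hi one mtail
    (fun x => sqr_tail_ge0 c (dot w x))).
set m := dot w mu; set v := quadratic_form w Sigma.
have Yv i : (1 <= i <= n)%N -> ('V_P[Y i] = v%:E)%E.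
  by move=> hi; exact: variance_dot (XSigma i hi).
have Ym i : (1 <= i <= n)%N -> ('E_P[Y i] = m%:E)%E.
  by move=> hi; exact: expectation_dot (Xmu i hi).
have Ycov i j : (1 <= i <= n)%N -> (1 <= j <= n)%N -> i != j ->
    covariance P (Y i) (Y j) = 0%E.
  move=> hi hj ij.
  by apply: (independent_covariance0 indX) => //; [exact: measurable_dot|
    exact: Y2|exact: Y2].
have Vcov i j : (1 <= i <= n)%N -> (1 <= j <= n)%N -> i != j ->
    covariance P (V i) (V j) = 0%E.
  move=> hi hj ij.
  (* V_i is one measurable function [g] of X_i, so the V_i inherit zero correlation from the
     independence of the X_i. *)
  pose g (x : borel_cV R p) : R := dot w x ^+ 2 - sqr_tail c (dot w x).
  apply: (independent_covariance0 (f := g) indX) => //; try exact: V2.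
  by apply: measurable_funB => //; apply: measurable_funX; exact: measurable_dot.
have v0 : 0 <= v by rewrite -lee_fin -(Yv 1%N)// variance_ge0.
(* v + m^2 = E Y_1^2 = E V_1 + E W_1, with V_1 <= c. As both summands on the left are nonnegative,
   each is at most c + eps. *)
have vm_le : v + m ^+ 2 <= c + eps.
  have V1 : V 1%N \in Lfun P 1 := Lfun_subset12 Pfin (V2 1%N).
  have VW : (Y 1%N ^+ 2)%R = V 1%N \+ W 1%N.
    by apply/funext => t /=; rewrite subrK.
  have W1L : W 1%N \in Lfun P 1.
    rewrite (_ : W 1%N = (Y 1%N \* Y 1%N) \- V 1%N).
      by rewrite rpredB// Lfun2_mul_Lfun1 ?Y2.
    by apply/funext => t; rewrite /V /= -expr2 opprB addrC subrK.
  have EVc : ('E_P[V 1%N] <= c%:E)%E.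
    rewrite -(expectation_cst P); apply: expectation_le => // [t|].
      by have /andP[] := Vc 1%N t.
    by apply: aeW => t; have /andP[] := Vc 1%N t.
  have := varianceE (Y2 1%N one); rewrite Yv// Ym// VW expectationD// W1.
  move: EVc; rewrite -(fineK (expectation_fin_num V1)) lee_fin => EVc.
  by rewrite -EFin_expe -!EFinD => -[->]; rewrite subrK lerD.
have [S1 le_S] := variance_L1_bound n0 d0 Y2 Ym Yv Ycov (fun i _ => V2 i)
  (fun i _ => variance_bounded P (mV i) (Vc i)) Vcov
  (fun i t => sqr_tail_ge0 c (Y i t)) (fun i t => esym (subrK _ _)) Womega.
have SE : S = (fun t => n%:R^-1 * \sum_(1 <= i < n.+1)
    (Y i t - n%:R^-1 * \sum_(1 <= i < n.+1) Y i t) ^+ 2).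
  by apply/funext => t; rewrite /S /weighted_sample_variance dot_sample_mean.
rewrite SE; split=> //; apply: (le_trans le_S).
have m0 := sqr_ge0 m.
rewrite lee_fin; apply: lerD.
  by apply: lerD; [rewrite ler_pM2l|rewrite ler_pM2l// lerD2l; lra].
rewrite ler_pM2r ?invr_gt0 ?ltr0n//.
apply: lerD; first by apply: lerD => //; lra.
by rewrite ler_pM2r ?invr_gt0//; lra.
Qed.


(** * Consequences of L^1 convergence *)

(** The bound with e = 1 makes [u n] eventually finite, which reduces the limit to one of real
    numbers. *)
Lemma ereal_cvg0 (R : realType) (u : nat -> \bar R) :
    (forall e : R, 0 < e -> \forall n \near \oo, (`|u n| <= e%:E)%E) ->
  u n @[n --> \oo] --> 0%E.
Proof.
move=> ue.
have ufin : \forall n \near \oo, u n \is a fin_num.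
  apply: filterS (ue 1 ltr01) => n un1.
  by rewrite fin_num_abs (le_lt_trans un1)// ltry.
apply/fine_cvgP; split=> //; apply/cvgrPdist_le => e e0.
apply: filterS2 ufin (ue e e0) => n ufin une.
by rewrite sub0r normrN -lee_fin -fine_abse// fineK// abse_fin_num.
Qed.

Section L1_convergence.
Context d (T : measurableType d) (R : realType) (P : probability T R).
(** The centring [a] may vary with [n]: it will be the quadratic form w_n' Sigma_n w_n as well as
    the constant limit. *)
Variables (S : nat -> T -> R) (a : nat -> R).
Hypothesis S_L1 : forall e : R, 0 < e -> \forall n \near \oo,
  S n \in Lfun P 1 /\ ('E_P[(fun t => `|S n t - a n|)%R] <= e%:E)%E.

Lemma L1_cvg_in_probability :
  cvg_in_probability P (fun n t => S n t - a n) (cst 0).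
Proof.
move=> e e0; apply: ereal_cvg0 => r r0.
(* Markov's inequality divides the L^1 bound by [e], so r * e is requested in order to end with
   [r]. *)
have re0 : 0 < r * e by rewrite mulr_gt0.
apply: filterS (S_L1 re0) => n [S1 ES].
rewrite gee0_abs//.
have mD : measurable_fun [set: T] (fun t => S n t - a n).
  by apply: measurable_funB => //; exact: Lfun_measurable S1.
pose Dmix := isMeasurableFun.Build _ _ _ _ _ mD.
pose D : {RV P >-> R} := HB.pack (fun t => S n t - a n) Dmix.
have := @markov _ _ _ P D id e e0 (@measurable_id _ _ _) (fun _ => id)
  (fun x y _ _ => id).
move=> /le_trans => /(_ _ ES).
rewrite mulrC EFinM => He.
rewrite -(@lee_pmul2l _ e%:E)//; apply: le_trans He.
rewrite lee_pmul2l//.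
pose N t := `|S n t - a n|.
have mN (I : interval R) : measurable (N @^-1` [set` I]).
  rewrite -[_ @^-1` _]setTI.
  by apply: (measurableT_comp _ mD) => //; exact: measurable_itv.
(* Markov controls the event e <= |S n - a n|, which contains the strict event of the definition. *)
apply: le_measure; rewrite ?inE.
- rewrite (_ : [set _ | _] = N @^-1` `]e, +oo[)//.
  by apply/seteqP; split=> t; rewrite /N /= subr0 in_itv/= andbT.
- rewrite (_ : [set _ | _] = N @^-1` `[e, +oo[)//.
  by apply/seteqP; split=> t; rewrite /N /= lee_fin in_itv/= andbT.
- by move=> t /=; rewrite subr0 lee_fin => /ltW.
Qed.

(** |E S - a| <= E |S - a|. *)
Lemma L1_cvg_expectation : ('E_P[S n] - (a n)%:E)%E @[n --> \oo] --> 0%E.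
Proof.
apply: ereal_cvg0 => e e0.
apply: filterS (S_L1 e0) => n [S1 ES].
rewrite -(expectation_cst P) -expectationB ?Lfun_cst//.
apply: le_trans ES; rewrite unlock; apply: le_abse_integral => //.
apply/measurable_EFinP.
by apply: measurable_funB => //; exact: Lfun_measurable S1.
Qed.

End L1_convergence.

(** * Consistency and asymptotic unbiasedness of the variance estimator *)

Theorem theorem3p2 (d : measure_display) (T : measurableType d) (R : realType)
    (P : probability T R) (p : nat -> nat)
    (X : forall n : nat, nat -> {RV P >-> borel_cV R (p n)})
    (mu : forall n : nat, 'cV[R]_(p n)) (Sigma : forall n : nat, 'M[R]_(p n))
    (w : forall n : nat, 'cV[R]_(p n)) (sigma_w : R)
    (X_iid : forall n : nat, (1 <= n)%N ->
      iid [set i : nat | (1 <= i <= n)%N] (X n))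
    (X_mean : forall n i : nat, (1 <= i <= n)%N ->
      has_mean_vector P (X n i) (mu n))
    (X_cov : forall n i : nat, (1 <= i <= n)%N ->
      has_covariance_matrix P (X n i) (Sigma n))
    (sigma_w_gt0 : 0 < sigma_w ^+ 2)
    (sigma_w_lim :
      quadratic_form (w n) (Sigma n) @[n --> \oo] --> sigma_w ^+ 2)
    (X_truncated : forall r k : nat, r \in [:: 1; 2]%N -> (1 <= k <= r)%N ->
      ereal_sup [set 'E_P[(fun t => `|dot (w n) (X n 1%N t)| ^+ r *
                            \1_[set s | c < `|dot (w n) (X n 1%N s)| ^+ k] t)%R]%E
                | n in [set n : nat | (1 <= n)%N]]
        @[c --> +oo%R] --> 0%E) :
  let sigma_hat2 (n : nat) (t : T) : R :=
    weighted_sample_variance n (w n) (fun i => X n i t) in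
  (cvg_in_probability P
      (fun n t => sigma_hat2 n t - quadratic_form (w n) (Sigma n)) (cst 0) /\
   cvg_in_probability P sigma_hat2 (cst (sigma_w ^+ 2))) /\
  (('E_P[sigma_hat2 n] - (quadratic_form (w n) (Sigma n))%:E)%E
      @[n --> \oo] --> 0%E /\
   'E_P[sigma_hat2 n]%E @[n --> \oo] --> (sigma_w ^+ 2)%:E).
Proof.
move=> S.
pose v n := quadratic_form (w n) (Sigma n).
have [S_L1 S_L1_bound] : (forall n, (0 < n)%N -> S n \in Lfun P 1) /\
    forall e : R, 0 < e -> \forall n \near \oo,
      ('E_P[(fun t => `|S n t - v n|)%R] <= e%:E)%E.
  have bound n c eps delta n0 c0 d0 := @weighted_sample_variance_L1_bound
    _ _ _ P _ n (X n) (mu n) (w n) (Sigma n) c eps delta n0 c0 d0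
    (X_iid n n0) (X_mean n) (X_cov n).
  (* The supremum over [n] in the truncation hypothesis yields one threshold [c] valid for every
     sample size. *)
  have tail (eps : R) : 0 < eps -> exists2 c : R, 0 <= c & forall n, (0 < n)%N ->
      ('E_P[(sqr_tail c \o (dot (w n) \o X n 1%N))%R] <= eps%:E)%E.
    move=> eps0.
    have /fine_cvgP[Ffin /cvgrPdist_le/(_ eps eps0) Feps] :=
      X_truncated 2%N 2%N isT isT.
    (* [c] must also make the supremum finite: [fine] of an infinite value is 0, so smallness of
       [fine] alone would prove nothing. *)
    have [c [[c0 cfin] c_eps]] := filter_ex (filterI (filterI
      (nbhs_pinfty_ge (num_real 0)) Ffin) Feps).
    exists c => // n n0.
    move: c_eps; rewrite sub0r normrN -lee_fin => c_eps.
    apply: (@le_trans _ _ _ _ _ _ c_eps).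
    rewrite -fine_abse// fineK ?abse_fin_num//.
    apply: le_trans (lee_abs _).
    by apply: ereal_sup_ubound; exists n.
  split=> [n n0|e e0].
    (* Integrability follows from the bound with any parameters; all are set to 1. *)
    have [c c0 tail_c] := tail 1 ltr01.
    by have [] := bound n c 1 1 n0 c0 ltr01 (tail_c n n0).
  (* Order of choice: [eps], then [c], then [delta] depending on [c], and finally [n]. The terms 2 *
     eps, delta * (1 + K) and C / n each contribute at most e / 4. *)
  pose eps := e / 8.
  have eps0 : 0 < eps by rewrite divr_gt0.
  have [c c0 tail_c] := tail eps eps0.
  pose K := c + eps.
  have K0 : 0 < K by rewrite ltr_wpDl.
  pose delta := e / (4 * (1 + K)).
  have d0 : 0 < delta by rewrite divr_gt0// mulr_gt0// addr_gt0.
  near=> n.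
  have n0 : (0 < n)%N by near: n; exists 1%N.
  have [_ /le_trans] := bound n c eps delta n0 c0 d0 (tail_c n n0).
  apply; rewrite lee_fin -/K.
  set C := c ^+ 2 / delta + K + K / delta.
  have C_n : C / n%:R <= e / 4.
    rewrite ler_pdivrMr ?ltr0n// mulrC -ler_pdivrMr ?divr_gt0//.
    by near: n; exact: nbhs_infty_ger.
  have -> : delta * (1 + K) = e / 4.
    by rewrite /delta; field; rewrite gt_eqF// addr_gt0.
  rewrite /eps; move: C_n; set x := C / _; lra.
have near_pos : \forall n \near \oo, (0 < n)%N by exists 1%N.
have Sv e : 0 < e -> \forall n \near \oo,
    S n \in Lfun P 1 /\ ('E_P[(fun t => `|S n t - v n|)%R] <= e%:E)%E.
  move=> e0; apply: filterS2 near_pos (S_L1_bound e e0) => n n0 ?.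
  by split=> //; exact: S_L1.
(* Triangle inequality through [v n]: half of [e] covers E |S n - v n|, the other half the
   deterministic distance from [v n] to its limit. *)
have Ssigma e : 0 < e -> \forall n \near \oo,
    S n \in Lfun P 1 /\ ('E_P[(fun t => `|S n t - sigma_w ^+ 2|)%R] <= e%:E)%E.
  move=> e0; have e20 : 0 < e / 2 by rewrite divr_gt0.
  have /cvgrPdist_le/(_ _ e20) v_lim := sigma_w_lim.
  apply: filterS2 (Sv _ e20) v_lim => n [S1 ES] vn; split=> //.
  have D1 : (fun t => `|S n t - v n|) \in Lfun P 1.
    by apply: (@Lfun_norm _ _ _ _ (S n \- cst (v n))); rewrite rpredB ?Lfun_cst.
  apply: (@le_trans _ _ ('E_P[((fun t => `|S n t - v n|) \+ cst (e / 2))%R])%E).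
    apply: expectation_le => //.
    - apply: (Lfun_measurable (P := P) (r := 1%E)).
      apply: (@Lfun_norm _ _ _ _ (S n \- cst (sigma_w ^+ 2))).
      by rewrite rpredB ?Lfun_cst.
    - by apply: (Lfun_measurable (P := P) (r := 1%E)); rewrite rpredD ?Lfun_cst.
    - by move=> t; rewrite /= addr_ge0// ltW.
    - apply: aeW => t /=; rewrite (le_trans (ler_distD (v n) _ _))// lerD2l.
      by rewrite distrC.
  rewrite expectationD ?Lfun_cst// expectation_cst.
  by rewrite [in leRHS](splitr e) EFinD leeD.
split; split.
- exact: (@L1_cvg_in_probability _ _ _ P S v Sv).
- have := @L1_cvg_in_probability _ _ _ P S (fun=> sigma_w ^+ 2) Ssigma.
  move=> prob e e0; apply: cvg_trans (prob e e0).
  apply: near_eq_cvg; apply: nearW => n.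
  by congr (P _); apply/seteqP; split=> t /=; rewrite subr0.
- exact: (@L1_cvg_expectation _ _ _ P S v Sv).
- have Ssigma0 := @L1_cvg_expectation _ _ _ P S (fun=> sigma_w ^+ 2) Ssigma.
  (* The finite constant is added back to the limit of the centred expectations. *)
  have : (('E_P[S n] - (sigma_w ^+ 2)%:E) + (sigma_w ^+ 2)%:E)%E @[n --> \oo]
      --> (0 + (sigma_w ^+ 2)%:E)%E.
    by apply: cvgeD => //; exact: cvg_cst.
  by rewrite add0e; under eq_fun do rewrite subeK//.
Unshelve. all: by end_near. Qed.
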